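(* Let $N\ge2$ be an integer and $x\in[0,1]\setminus\mathbb{Q}$. The topological dynamical systems $(X_{\omega(x,N)},\Sigma)$ and $(X_{\widehat\omega(x,N)},\Sigma)$ are uniquely ergodic, i.e. each has exactly one $\Sigma$-invariant (Borel) probability measure.
   Context: Let $N\ge 1$ be an integer and define $T_N:[0,1]\to[0,1]$ by $T_N(x)=\frac{N}{x}-\lfloor\frac{N}{x}\rfloor$ for $x\ne0$ and $T_N(0)=0$. For $x\in[0,1]\setminus\mathbb{Q}$ the (greedy) NCF digits of $x$ are $d_n=\lfloor N/T_N^{n-1}(x)\rfloor\ge N$, $n\ge1$; one writes $x=[0;d_1,d_2,\ldots]_N$. A substitution on $\{0,1\}$ is given by images of the letters (nonempty words) and extends to finite and infinite words by concatenation. For $x=[0;d_1,d_2,\ldots]_N$ irrational let $\sigma_n(0)=0^{d_n}1^N$, $\sigma_n(1)=0$ and $\widehat\sigma_n(0)=0^{d_n}1$, $\widehat\sigma_n(1)=0^N$ for $n\ge1$. The NCF sequence $\omega(x,N)\in\{0,1\}^{\mathbb N}$ is the unique infinite word $\omega$ for which there exist $\omega^{(1)},\omega^{(2)},\ldots\in\{0,1\}^{\mathbb{N}}$ with $\omega^{(1)}=\omega$ and $\omega^{(n)}=\sigma_n(\omega^{(n+1)})$ for all $n\ge1$. The dual NCF sequence $\widehat\omega(x,N)$ is defined in the same way with $\widehat\sigma_n$ in place of $\sigma_n$. $\{0,1\}^{\mathbb{N}}$ carries the product topology of the discrete topologies, $\Sigma$ is the left shift $\Sigma(\nu_0\nu_1\nu_2\cdots)=\nu_1\nu_2\cdots$,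 and for a sequence $\nu$, $X_\nu=\overline{\{\Sigma^n(\nu):n\in\mathbb{N}\}}$. *)

(* Defs.v *)
From HB Require Import structures.
From mathcomp Require Import all_boot all_order all_algebra.
From mathcomp Require Import all_classical all_reals all_analysis.
From mathcomp Require Import zify.

Set Implicit Arguments.
Unset Strict Implicit.
Unset Printing Implicit Defensive.

Import Order.TTheory GRing.Theory Num.Theory.

Local Open Scope classical_set_scope.
Local Open Scope ring_scope.

Definition ncf_map (R : realType) (N : nat) (x : R) : R :=
  if x == 0 then 0 else N%:R / x - (Num.floor (N%:R / x))%:~R.

(** [ncf_digit N x n] is d_(n+1): indices are shifted so as to start at 0.
    [Num.truncn] is the floor, as a natural number, of a nonnegative real. *)
Definition ncf_digit (R : realType) (N : nat) (x : R) (n : nat) : nat :=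
  Num.truncn (N%:R / iter n (ncf_map N) x).

(** The letter 0 is [false], the letter 1 is [true]. *)
Definition substitution := bool -> seq bool.

Definition subst_word (s : substitution) (u : seq bool) : seq bool :=
  flatten (map s u).

(** The extension of a substitution to infinite words. Images of letters are
    nonempty, hence the image of the first [i.+1] letters of [w] is a prefix of
    the image of [w] of length at least [i.+1]. *)
Definition subst_inf (s : substitution) (w : cantor_space) : cantor_space :=
  fun i => nth false (subst_word s (mkseq w i.+1)) i.

(** [w = w^(1)] for some words [w^(n)] with [w^(n) = s_n (w^(n+1))]. *)
Definition is_limit_word (s : nat -> substitution) (w : cantor_space) : Prop :=
  exists ws : nat -> cantor_space,
    ws 0%N = w /\ forall n, ws n = subst_inf (s n) (ws n.+1).

Definition ncf_subst (R : realType) (N : nat) (x : R) (n : nat) :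
    substitution :=
  fun b => if b then [:: false]
           else nseq (ncf_digit N x n) false ++ nseq N true.

Definition dual_ncf_subst (R : realType) (N : nat) (x : R) (n : nat) :
    substitution :=
  fun b => if b then nseq N false
           else nseq (ncf_digit N x n) false ++ [:: true].

(** The next lemmas show that [is_limit_word] determines a unique word for the
    substitutions defining NCF sequences and dual NCF sequences. *)
Section limit_word.
Variable s : nat -> substitution.
Hypothesis s_nonempty : forall n b, (0 < size (s n b))%N.
Hypothesis s_head : forall n b, nth false (s n b) 0 = false.
Hypothesis s_false_size : forall n, (1 < size (s n false))%N.

Local Notation sw n := (subst_word (s n)).

Let subst_word_cat n u v : sw n (u ++ v) = sw n u ++ sw n v.
Proof. by rewrite /subst_word map_cat flatten_cat. Qed.

Let size_subst_word n u : (size u <= size (sw n u))%N.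
Proof.
elim: u => //= a u IH; rewrite /subst_word /= size_cat -/(sw n u).
by have := s_nonempty n a; lia.
Qed.

Let mkseqD (w : nat -> bool) m n :
  exists v, mkseq w (m + n) = mkseq w m ++ v.
Proof. by rewrite /mkseq iotaD map_cat; eexists. Qed.

Let subst_inf_nth k (w : cantor_space) n i : (i < size (sw k (mkseq w n)))%N ->
  subst_inf (s k) w i = nth false (sw k (mkseq w n)) i.
Proof.
move=> ilt; rewrite /subst_inf.
have ilt' : (i < size (sw k (mkseq w i.+1)))%N.
  by apply: leq_trans (size_subst_word _ _); rewrite size_mkseq.
have [le|lt] := leqP n i.+1.
  have [v] := mkseqD w n (i.+1 - n); rewrite subnKC// => ->.
  by rewrite subst_word_cat nth_cat ilt.
have [v] := mkseqD w i.+1 (n - i.+1); rewrite subnKC 1?ltnW// => ->.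
by rewrite subst_word_cat nth_cat ilt'.
Qed.

(** [approx k m] is the image of 0 under [s_k o ... o s_(k+m-1)]. *)
Let Fixpoint approx (k m : nat) : seq bool :=
  if m is m'.+1 then sw k (approx k.+1 m') else [:: false].

Let approx_prefix m k : exists v, approx k m.+1 = approx k m ++ v.
Proof.
elim: m k => [|m IH] k.
  rewrite /= /subst_word /= cats0.
  case: (s k false) (s_nonempty k false) (s_head k false) => //= a v _ ->.
  by exists v.
have [v E] := IH k.+1.
by exists (sw k v); rewrite -subst_word_cat -E.
Qed.

Let approx_prefixD m n k : exists v, approx k (m + n) = approx k m ++ v.
Proof.
elim: n => [|n [v IH]]; first by exists [::]; rewrite addn0 cats0.
have [v' E] := approx_prefix (m + n) k.
by exists (v ++ v'); rewrite addnS E IH catA.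
Qed.

Let approx_size m k : (m < size (approx k m))%N.
Proof.
elim: m k => // m IH k.
have [v] := approx_prefixD 0 m k.+1; rewrite add0n /= => E.
have := IH k.+1; rewrite E /subst_word /= size_cat -/(sw k v).
by have := s_false_size k; have := size_subst_word k v; lia.
Qed.

Let limit (k : nat) : cantor_space := fun i => nth false (approx k i) i.

Let limit_nth k m i : (i < size (approx k m))%N ->
  limit k i = nth false (approx k m) i.
Proof.
move=> ilt; rewrite /limit; have [le|/ltnW le] := leqP m i.
  have [v] := approx_prefixD m (i - m) k; rewrite subnKC// => ->.
  by rewrite nth_cat ilt.
have [v] := approx_prefixD i (m - i) k; rewrite subnKC// => ->.
by rewrite nth_cat approx_size.
Qed.

Let limit_eq k : limit k = subst_inf (s k) (limit k.+1).
Proof.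
apply/funext => i.
have E : mkseq (limit k.+1) (size (approx k.+1 i)) = approx k.+1 i.
  apply: (@eq_from_nth _ false); rewrite size_mkseq// => j jlt.
  by rewrite nth_mkseq// (limit_nth jlt).
have ilt : (i < size (sw k (approx k.+1 i)))%N.
  exact: leq_trans (approx_size _ _) (size_subst_word _ _).
rewrite (@subst_inf_nth _ _ (size (approx k.+1 i))) E//.
exact: (@limit_nth k i.+1).
Qed.

Let limit_unique (ws : nat -> cantor_space) :
  (forall n, ws n = subst_inf (s n) (ws n.+1)) ->
  forall m k, mkseq (ws k) (size (approx k m)) = approx k m.
Proof.
move=> wsE; elim=> [|m IH] k.
  rewrite /mkseq /= wsE /subst_inf /subst_word /= cats0.
  by rewrite s_head.
apply: (@eq_from_nth _ false); rewrite size_mkseq// => i ilt.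
rewrite nth_mkseq// wsE /= -(IH k.+1); apply: subst_inf_nth.
by rewrite IH.
Qed.

Lemma limit_word_unique : exists! w, is_limit_word s w.
Proof.
exists (limit 0); split; first by exists limit; split => //; exact: limit_eq.
move=> w [ws [<- wsE]]; apply/funext => i.
have := limit_unique wsE i 0; move/(congr1 (fun u => nth false u i)).
by rewrite nth_mkseq.
Qed.

End limit_word.

Section digits.
Variables (R : realType) (N : nat) (x : R).
Hypotheses (N0 : (0 < N)%N) (x01 : 0 <= x <= 1) (x_irr : irrational x).

Let iter_ncf_map n :
  0 <= iter n (ncf_map N) x <= 1 /\ irrational (iter n (ncf_map N) x).
Proof.
elim: n => // n [_]; rewrite iterS; set y := iter _ _ _ => y_irr.
have y0 : y != 0.
  by apply/eqP => y0; apply: y_irr; exists 0; rewrite // rmorph0.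
rewrite /ncf_map (negbTE y0); split.
  by rewrite subr_ge0 ge_floor lerBlDl -intrD1 ltW ?floorD1_gt.
move=> [q _ qE]; apply: y_irr.
exists (N%:R / (q + (Num.floor (N%:R / y))%:~R)) => //.
by rewrite fmorph_div/= rmorphD/= ratr_nat ratr_int qE subrK invf_div mulrC
  divfK// pnatr_eq0 -lt0n.
Qed.

Lemma ncf_digit_ge n : (N <= ncf_digit N x n)%N.
Proof.
have [/andP[y_ge0 y_le1] y_irr] := iter_ncf_map n.
have y0 : iter n (ncf_map N) x != 0.
  by apply/eqP => y0; apply: y_irr; exists 0; rewrite // rmorph0.
have y_gt0 : 0 < iter n (ncf_map N) x by rewrite lt_def y0.
rewrite /ncf_digit truncn_ge_nat; last by rewrite divr_ge0.
by rewrite ler_pdivlMr// ler_piMr.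
Qed.

Let digit_gt0 n : (0 < ncf_digit N x n)%N.
Proof. exact: leq_trans N0 (ncf_digit_ge n). Qed.

Lemma ncf_seq_unique : exists! w, is_limit_word (ncf_subst N x) w.
Proof.
apply: limit_word_unique => n => [[]|[]|] //=; have := digit_gt0 n;
  rewrite ?size_cat ?size_nseq; first lia; last lia.
by case: ncf_digit.
Qed.

Lemma dual_ncf_seq_unique : exists! w, is_limit_word (dual_ncf_subst N x) w.
Proof.
apply: limit_word_unique => n => [[]|[]|] //=; have := digit_gt0 n;
  rewrite ?size_cat ?size_nseq /=; try lia.
- by rewrite nth_nseq; case: ifP.
- by case: ncf_digit.
Qed.

End digits.

(** [get P] is some element of [P] (if there is one); existence and uniqueness
    of the words below are [ncf_seq_unique] and [dual_ncf_seq_unique]. *)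
Definition ncf_seq (R : realType) (N : nat) (x : R) : cantor_space :=
  get (is_limit_word (ncf_subst N x)).

Definition dual_ncf_seq (R : realType) (N : nat) (x : R) : cantor_space :=
  get (is_limit_word (dual_ncf_subst N x)).

Definition left_shift (nu : cantor_space) : cantor_space := fun n => nu n.+1.

Definition orbit_closure (nu : cantor_space) : set cantor_space :=
  closure [set iter n left_shift nu | n in [set: nat]].

Lemma left_shift_continuous : continuous left_shift.
Proof.
move=> nu; apply/cvg_sup => n; move: nu.
apply: (@continuous_comp_initial _ _ _ (fun f : cantor_space => f n) left_shift).
exact: (@proj_continuous _ (fun _ : nat => bool) n.+1).
Qed.

Lemma orbit_closure_self nu : orbit_closure nu nu.
Proof. by apply: subset_closure; exists 0. Qed.

Lemma orbit_closure_shift nu mu :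
  orbit_closure nu mu -> orbit_closure nu (left_shift mu).
Proof.
move=> mu_in U /left_shift_continuous /mu_in [_ [[n _ <-] Un]].
by exists (iter n.+1 left_shift nu); split => //; exists n.+1.
Qed.

(** X_nu as a topological space, with the subspace topology. *)
Definition subshift (nu : cantor_space) : Type := set_type (orbit_closure nu).

HB.instance Definition _ nu := Topological.on (subshift nu).
(* measurable types are required to be inhabited *)
HB.instance Definition _ nu := isPointed.Build (subshift nu)
  (exist _ nu (mem_set (@orbit_closure_self nu))).

Definition subshift_map (nu : cantor_space) (mu : subshift nu) : subshift nu :=
  exist _ (left_shift (\val mu))
    (mem_set (orbit_closure_shift (set_mem (valP mu)))).

Definition borel (T : ptopologicalType) := g_sigma_algebraType (@open T).

Definition invariant_measure (R : realType) (T : ptopologicalType) (f : T -> T)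
    (mu : probability (borel T) R) : Prop :=
  forall A : set (borel T), measurable A -> mu (f @^-1` A) = mu A.

(** Measures are functions on all subsets, with meaningful values on measurable
    ones only, whence uniqueness is up to agreement on measurable sets. *)
Definition uniquely_ergodic (R : realType) (T : ptopologicalType) (f : T -> T)
    : Prop :=
  exists mu : probability (borel T) R, invariant_measure f mu /\
    forall mu' : probability (borel T) R, invariant_measure f mu' ->
      forall A : set (borel T), measurable A -> mu' A = mu A.

(* Main.v *)
(** Write the substitutions as 0 -> 0^d 1^a, 1 -> 0^b with d >= ab, and let
    W_m(0), W_m(1) be the images of the letters under the m-fold composition
    (so W_{m+1}(1) = W_m(0)^b). Counting occurrences of a fixed pattern is
    additive on words up to a bounded error, so the density p_m of the pattern
    in W_m(0) satisfies p_{m+2} = (1 - t) p_{m+1} + t p_m up to a geometrically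
    small error, where t = ab |W_m(0)| / |W_{m+2}(0)| <= 1/3. Hence p_m
    converges, the densities in W_m(0) and W_m(1) share their limit, and since
    the limit word is a concatenation of these two blocks for every m, every
    pattern occurs in it with a uniform frequency. By compactness these
    frequencies extend to a measure on the subshift, and integrating ergodic
    averages shows that every invariant measure is equal to it. *)
Require Import Defs.
From HB Require Import structures.
From mathcomp Require Import all_boot all_order all_algebra.
From mathcomp Require Import all_classical all_reals all_analysis.
From mathcomp Require Import measurable_realfun zify ring lra.

Set Implicit Arguments.
Unset Strict Implicit.
Unset Printing Implicit Defensive.

Import Order.TTheory GRing.Theory Num.Theory.

Local Open Scope classical_set_scope.
Local Open Scope ring_scope.

(** * Frequencies of patterns in limit words *)

Lemma subst_word_cat s u v :
  subst_word s (u ++ v) = subst_word s u ++ subst_word s v.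
Proof. by rewrite /subst_word map_cat flatten_cat. Qed.

Definition nonerasing (s : substitution) := forall b, (0 < size (s b))%N.

Lemma leq_size_subst_word s u :
  nonerasing s -> (size u <= size (subst_word s u))%N.
Proof.
move=> s_gt0; elim: u => //= b u IH; rewrite /subst_word /= size_cat.
by rewrite -/(subst_word s u) -add1n leq_add.
Qed.

(** Since no letter is erased, the image of the first [n] letters already has at least [n]
    letters. *)
Lemma take_subst_word s n u : nonerasing s ->
  take n (subst_word s (take n u)) = take n (subst_word s u).
Proof.
move=> s_gt0; rewrite -{2}(cat_take_drop n u) subst_word_cat.
have [un|nu] := leqP (size u) n.
  by rewrite drop_oversize// /subst_word /= cats0.
rewrite takel_cat//; apply: leq_trans (leq_size_subst_word _ s_gt0).
by rewrite size_take nu.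
Qed.

Lemma mkseq_subst_inf s w n : nonerasing s ->
  mkseq (subst_inf s w) n = take n (subst_word s (mkseq w n)).
Proof.
move=> s_gt0.
have size_ge k : (k <= size (subst_word s (mkseq w k)))%N.
  by apply: leq_trans (leq_size_subst_word _ s_gt0); rewrite size_mkseq.
apply: (@eq_from_nth _ false) => [|i]; rewrite size_mkseq.
  by rewrite size_takel.
move=> ltin; rewrite nth_mkseq// nth_take// /subst_inf.
have <- : take i.+1 (mkseq w n) = mkseq w i.+1.
  by rewrite -map_take take_iota; congr (map _ (iota _ _)); lia.
rewrite -(@nth_take i.+1)// take_subst_word// nth_take//.
Qed.

(** This is s_0 o ... o s_(m-1). The recursion peels off the innermost substitution, so the blocks
    of level m+1 are concatenations of blocks of level m. *)
Fixpoint subst_comp (s : nat -> substitution) m : substitution :=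
  fun b => if m is m'.+1 then subst_word (subst_comp s m') (s m' b)
           else [:: b].

Lemma subst_word_comp s m u :
  subst_word (subst_comp s m.+1) u =
  subst_word (subst_comp s m) (subst_word (s m) u).
Proof.
elim: u => // b u IH.
by rewrite -cat1s !subst_word_cat IH /subst_word /= !cats0.
Qed.

Lemma nonerasing_comp s m :
  (forall n, nonerasing (s n)) -> nonerasing (subst_comp s m).
Proof.
move=> s_gt0; elim: m => // m IH b.
exact: leq_trans (s_gt0 m b) (leq_size_subst_word _ IH).
Qed.

(** The witness is the prefix of length [n] of the word at level [m]; its image may overshoot, hence
    the [take]. *)
Lemma limit_word_prefix s w m n : (forall k, nonerasing (s k)) ->
  is_limit_word s w ->
  exists v, mkseq w n = take n (subst_word (subst_comp s m) v).
Proof.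
move=> s_gt0 [ws [<- wsE]]; exists (mkseq (ws m) n).
have comp_gt0 k := nonerasing_comp k s_gt0.
elim: m => [|m ->].
  suff -> : subst_word (subst_comp s 0) (mkseq (ws 0) n) = mkseq (ws 0) n.
    by rewrite take_oversize// size_mkseq.
  exact: flatten_seq1.
by rewrite wsE mkseq_subst_inf// take_subst_word// subst_word_comp.
Qed.

(** The radius 2K/2^n is the sum of all remaining step bounds, so the intervals of this radius
    around [p n] are nested; [c] is the supremum of their lower ends. *)
Lemma cvg_of_geometric_step (R : realType) (p : nat -> R) (K : R) :
  (forall n, `|p n.+1 - p n| <= K / 2 ^+ n) ->
  exists c, forall n, `|p n - c| <= 2 * K / 2 ^+ n.
Proof.
move=> step.
pose lo n := p n - 2 * K / 2 ^+ n; pose hi n := p n + 2 * K / 2 ^+ n.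
have halve n : 2 * K / 2 ^+ n = K / 2 ^+ n + 2 * K / 2 ^+ n.+1.
  by rewrite exprS; field; rewrite expf_neq0.
have lo_nd : {homo lo : m n / (m <= n)%N >-> m <= n}.
  apply/nondecreasing_seqP => n; have := step n.
  rewrite ler_norml /lo (halve n).
  by move: (K / _) (2 * K / _) => a b; lra.
have hi_ni : {homo hi : m n / (m <= n)%N >-> n <= m}.
  apply/nonincreasing_seqP => n; have := step n.
  rewrite ler_norml /hi (halve n).
  by move: (K / _) (2 * K / _) => a b; lra.
have lohi m n : lo m <= hi n.
  apply: (le_trans (lo_nd _ _ (leq_maxl m n))).
  apply: le_trans (hi_ni _ _ (leq_maxr m n)).
  have K0 : 0 <= 2 * K.
    by have := step 0; rewrite divr1 => /(le_trans (normr_ge0 _)); lra.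
  by rewrite /lo /hi lerBlDr -addrA lerDl addr_ge0// divr_ge0// exprn_ge0.
exists (sup (range lo)) => n.
have : lo n <= sup (range lo).
  apply: ub_le_sup; last by exists n.
  by exists (hi 0) => _ [m _ <-].
have : sup (range lo) <= hi n.
  by apply: ge_sup; [exists (lo 0), 0|move=> _ [m _ <-]].
by rewrite /lo /hi ler_distl; lra.
Qed.

Lemma size_subst_word_nseq s n b :
  size (subst_word s (nseq n b)) = (n * size (s b))%N.
Proof.
by rewrite /subst_word map_nseq size_flatten /shape map_nseq sumn_nseq mulnC.
Qed.

(** * Uniform averages of quasi-additive functions on words *)

Section uniform_frequency.
Variables (R : realType) (a b : nat) (d : nat -> nat) (s : nat -> substitution).
Hypotheses (a_gt0 : (0 < a)%N) (b_gt0 : (0 < b)%N).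
Hypotheses (d_gt1 : forall n, (1 < d n)%N) (ab_le : forall n, (a * b <= d n)%N).
Hypothesis s_false : forall n, s n false = nseq (d n) false ++ nseq a true.
Hypothesis s_true : forall n, s n true = nseq b false.

Variables (F : seq bool -> R) (L : R).
Hypothesis F_size : forall u, `|F u| <= (size u)%:R.
Hypothesis F_cat : forall u v, `|F (u ++ v) - (F u + F v)| <= L.

Let s_gt0 n : nonerasing (s n).
Proof.
case; first by rewrite s_true size_nseq.
by rewrite s_false size_cat size_nseq addn_gt0 (ltn_trans _ (d_gt1 n)).
Qed.

Local Notation W := (subst_comp s).

Let W_gt0 m : nonerasing (W m) := nonerasing_comp m s_gt0.

Let L_ge0 : 0 <= L.
Proof. exact: le_trans (normr_ge0 _) (F_cat [::] [::]). Qed.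

(** Each concatenation costs at most [L]; the empty word costs nothing, because [F_size] forces [F
    [::] = 0]. *)
Lemma quasi_additive_subst_word t u :
  `|F (subst_word t u) - \sum_(x <- u) F (t x)| <= (size u)%:R * L.
Proof.
elim: u => [|x u IH].
  by rewrite big_nil subr0 mul0r; exact: F_size.
rewrite -cat1s subst_word_cat {1}/subst_word /= cats0 big_cons -natr1.
have -> : F (t x ++ subst_word t u) - (F (t x) + \sum_(j <- u) F (t j)) =
  (F (t x ++ subst_word t u) - (F (t x) + F (subst_word t u))) +
  (F (subst_word t u) - \sum_(j <- u) F (t j)) by ring.
apply: (le_trans (ler_normD _ _)); rewrite mulrDl mul1r [leRHS]addrC.
exact: lerD.
Qed.

Let size_Wfalse m :
  size (W m.+1 false) = (d m * size (W m false) + a * size (W m true))%N.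
Proof. by rewrite /= s_false subst_word_cat size_cat !size_subst_word_nseq. Qed.

Let size_Wtrue m : size (W m.+1 true) = (b * size (W m false))%N.
Proof. by rewrite /= s_true size_subst_word_nseq. Qed.

Let F_Wfalse m : `|F (W m.+1 false) -
    ((d m)%:R * F (W m false) + a%:R * F (W m true))| <= (d m + a)%:R * L.
Proof.
have := quasi_additive_subst_word (W m) (s m false).
by rewrite {2 3}s_false big_cat !big_nseq !iter_addr_0 size_cat !size_nseq
  !mulr_natl.
Qed.

Let F_Wtrue m :
  `|F (W m.+1 true) - b%:R * F (W m false)| <= b%:R * L.
Proof.
have := quasi_additive_subst_word (W m) (s m true).
by rewrite {2 3}s_true big_nseq iter_addr_0 size_nseq !mulr_natl.
Qed.

Let size_Wfalse_ge m : (2 ^ m <= size (W m false))%N.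
Proof.
elim: m => // m IH; rewrite size_Wfalse expnS.
by apply: leq_trans (leq_addr _ _); rewrite leq_mul.
Qed.

Let size_WfalseSS m : size (W m.+2 false) =
  (d m.+1 * size (W m.+1 false) + a * b * size (W m false))%N.
Proof. by rewrite size_Wfalse size_Wtrue mulnA. Qed.

(** This is the bound t <= 1/3: from d_m >= 2 the length of W_m(0) at least doubles with each level,
    and with d_(m+1) >= ab the first summand of [size_WfalseSS] is at least twice the second. *)
Let size_WfalseSS_ge m :
  (3 * (a * b * size (W m false)) <= size (W m.+2 false))%N.
Proof.
rewrite size_WfalseSS (mulnDl 2 1) mul1n leq_add2r.
have : (2 * size (W m false) <= size (W m.+1 false))%N.
  by rewrite size_Wfalse (leq_trans _ (leq_addr _ _))// leq_mul2r d_gt1 orbT.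
move=> /(leq_mul (ab_le m.+1)); apply: leq_trans.
by rewrite mulnCA mulnA leqnn.
Qed.

Let F_WfalseSS m : `|F (W m.+2 false) - ((d m.+1)%:R * F (W m.+1 false) +
    (a * b)%:R * F (W m false))| <= 3 * (d m.+1)%:R * L.
Proof.
have -> : F (W m.+2 false) - ((d m.+1)%:R * F (W m.+1 false) +
    (a * b)%:R * F (W m false)) =
  (F (W m.+2 false) -
    ((d m.+1)%:R * F (W m.+1 false) + a%:R * F (W m.+1 true))) +
  a%:R * (F (W m.+1 true) - b%:R * F (W m false)) by rewrite natrM; ring.
apply: (le_trans (ler_normD _ _)); rewrite normrM normr_nat.
apply: (le_trans (lerD (F_Wfalse _) (ler_wpM2l _ (F_Wtrue _)))) => //.
rewrite mulrA -mulrDl ler_wpM2r//.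
(* Both [a] and [a * b] are at most [d m.+1]. *)
have : ((d m.+1 + a + a * b)%:R <= (3 * d m.+1)%:R :> R).
  have := ab_le m.+1; have : (a <= a * b)%N by rewrite leq_pmulr.
  by rewrite ler_nat; lia.
by rewrite natrD !natrM.
Qed.

Let p m := F (W m false) / (size (W m false))%:R.

Let size_gt0 m : 0 < (size (W m false))%:R :> R.
Proof. by rewrite ltr0n W_gt0. Qed.

Let F_p m : F (W m false) = p m * (size (W m false))%:R.
Proof. by rewrite divfK// gt_eqF. Qed.

(** Dividing [F_WfalseSS] by l2 = |W_{m+2}(0)| gives p_{m+2} - p_{m+1} = t (p_m - p_{m+1}) plus an
    error of at most 3 d L / l2. As d l1 <= l2 with l1 = |W_{m+1}(0)| >= 2^(m+1), the error is at
    most 3 L / 2^(m+1). *)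
Let p_step_le m :
  `|p m.+2 - p m.+1| <= 3^-1 * `|p m.+1 - p m| + 3 * L / 2 ^+ m.+1.
Proof.
have := F_WfalseSS m; have := size_WfalseSS m; have := size_WfalseSS_ge m.
rewrite !F_p.
have := size_gt0 m.+2; have := size_gt0 m.+1; have := size_gt0 m.
have := size_Wfalse_ge m.+1.
move: (size (W m.+2 _)) (size (W m.+1 _)) (size (W m _)) => l2 l1 l0.
rewrite -(ler_nat R) natrX => l1_ge l0_gt0 l1_gt0 l2_gt0.
rewrite -(ler_nat R) natrM => l2_ge l2E.
have d_gt0 : 0 < (d m.+1)%:R :> R by rewrite ltr0n (ltn_trans _ (d_gt1 _)).
have ab_ge0 : 0 <= (a * b)%:R * l0%:R :> R by rewrite -natrM.
have l2ER : l2%:R = (d m.+1)%:R * l1%:R + (a * b)%:R * l0%:R :> R.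
  by rewrite l2E natrD !natrM.
move=> err.
have dl1_le : (d m.+1)%:R * l1%:R <= l2%:R :> R by rewrite l2ER lerDl.
rewrite -(ler_pM2r l2_gt0) -[X in _ * X]gtr0_norm// -normrM [leRHS]mulrDl.
have -> : (p m.+2 - p m.+1) * l2%:R = (p m.+2 * l2%:R -
   ((d m.+1)%:R * (p m.+1 * l1%:R) + (a * b)%:R * (p m * l0%:R))) +
   (a * b)%:R * l0%:R * (p m - p m.+1) by rewrite [in RHS]mulrC l2ER; ring.
apply: (le_trans (ler_normD _ _)); rewrite addrC; apply: lerD.
  rewrite normrM ger0_norm// distrC mulrC mulrAC [leRHS]mulrC ler_wpM2l//.
  by rewrite natrM in l2_ge; lra.
apply: (le_trans err).
rewrite [leRHS]mulrAC ler_pdivlMr ?exprn_gt0// -!mulrA ler_wpM2l// mulrCA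
  ler_wpM2l//.
apply: le_trans dl1_le; rewrite ler_wpM2l//; exact: ltW.
Qed.

(** The constant K = 9L + 2 serves both cases: K >= 2 starts the induction since densities are at
    most 1 in absolute value, and K/3 + 3L/2 <= K/2 holds as soon as K >= 9L. *)
Let p_step m : `|p m.+1 - p m| <= (9 * L + 2) / 2 ^+ m.
Proof.
elim: m => [|m IH].
  rewrite divr1; have p_le1 m : `|p m| <= 1.
    by rewrite normrM normfV normr_nat ler_pdivrMr// mul1r.
  apply: (le_trans (ler_normB _ _)).
  by have := p_le1 0; have := p_le1 1; move: L_ge0; lra.
apply: (le_trans (p_step_le _)); move: IH; rewrite exprS.
have : 0 < (2 ^+ m)^-1 :> R by rewrite invr_gt0 exprn_gt0.
rewrite invfM; move: (_^-1) `|_| => h x h_gt0 xh.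
have : 0 <= L * h by rewrite mulr_ge0// ltW.
by move: xh; rewrite mulrDl; lra.
Qed.

(** Besides the density, the second bound makes the blocks so long that the cost [L] of one
    concatenation per block is negligible. *)
Lemma exists_block_frequency : exists c : R, forall e, 0 < e ->
  exists m, forall x,
    `|F (W m x) - c * (size (W m x))%:R| <= e * (size (W m x))%:R /\
    L <= e * (size (W m x))%:R.
Proof.
have [c pc] := cvg_of_geometric_step p_step; exists c => e e0.
(* [M / 2 ^+ i] bounds the distance of [p i] from [c] together with [L / 2 ^+ i], which dominates
   the cost [L] relative to the length of the block. *)
pose M := 2 * (9 * L + 2) + L.
have M_ge0 : 0 <= M by rewrite /M; move: L_ge0; lra.
have [j Mj] : exists j, M / 2 ^+ j <= e.
  have /archi_boundP : 0 <= M / e by rewrite divr_ge0// ltW.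
  move: (Num.bound _) => j Mj; exists j.
  rewrite ler_pdivrMr ?exprn_gt0// mulrC -ler_pdivrMr// (le_trans (ltW Mj))//.
  by rewrite -natrX ler_nat ltnW// ltn_expl.
have pe i : (j <= i)%N -> `|p i - c| + L / 2 ^+ i <= e.
  move=> ji; apply: le_trans Mj.
  have : M / 2 ^+ i <= M / 2 ^+ j.
    by rewrite ler_wpM2l// lef_pV2 ?posrE ?exprn_gt0// ler_weXn2l// ler1n.
  by apply: le_trans; rewrite /M [in leRHS]mulrDl lerD2r.
have Le i : (j <= i)%N -> L <= e * (size (W i false))%:R.
  move=> /pe; have : 0 <= `|p i - c| by [].
  move=> p0 pLe.
  have {p0 pLe}: L / 2 ^+ i <= e by lra.
  rewrite ler_pdivrMr ?exprn_gt0// => /le_trans; apply.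
  by rewrite ler_wpM2l ?(ltW e0)// -natrX ler_nat.
(* One level above [j], the block of 1 is a power of a block of 0 of level [j], so both blocks are
   controlled. *)
exists j.+1; case.
  rewrite size_Wtrue natrM; split; last first.
    apply: (le_trans (Le j (leqnn j))).
    by rewrite ler_wpM2l ?(ltW e0)// -natrM ler_nat leq_pmull.
  have -> : F (W j.+1 true) - c * (b%:R * (size (W j false))%:R) =
    F (W j.+1 true) - b%:R * F (W j false) +
    b%:R * (p j - c) * (size (W j false))%:R by rewrite F_p; ring.
  apply: (le_trans (ler_normD _ _)); rewrite !normrM !normr_nat.
  apply: (le_trans (lerD (F_Wtrue j) (lexx _))).
  rewrite [leRHS]mulrCA -mulrA -mulrDr ler_wpM2l//.
  apply: le_trans (ler_wpM2r _ (pe j (leqnn j))) => //.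
  rewrite mulrDl [leRHS]addrC lerD2r mulrAC ler_pdivlMr ?exprn_gt0//.
  by rewrite ler_wpM2l// -natrX ler_nat.
split; last exact: Le.
rewrite F_p -mulrBl normrM normr_nat ler_wpM2r//.
have := pe _ (leqnSn j); apply: le_trans.
by rewrite lerDl divr_ge0// exprn_ge0.
Qed.

Lemma uniform_frequency w : is_limit_word s w ->
  exists c : R, forall e, 0 < e -> exists n0, forall n k, (n0 <= n)%N ->
    `|F (take n (drop k (mkseq w (k + n)))) - c * n%:R| <= e * n%:R.
Proof.
move=> w_lim.
have [c c_freq] := exists_block_frequency; exists c => e e0.
(* One third each for the density of the blocks, the concatenations, and the two incomplete blocks
   at the ends. *)
have e3_gt0 : 0 < e / 3 by rewrite divr_gt0.
have [m blk] := c_freq _ e3_gt0.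
pose B := (size (W m true) + size (W m false))%N.
have W_le x : (size (W m x) <= B)%N.
  by case: x; rewrite ?leq_addr ?leq_addl.
(* This bounds the deviation of an incomplete block plus the cost of attaching it. *)
pose C := (1 + `|c|) * B%:R + L.
have C_ge0 : 0 <= C by rewrite addr_ge0// mulr_ge0// addr_ge0.
have short u : (size u <= B)%N -> `|F u - c * (size u)%:R| <= C - L.
  move=> uB; apply: (le_trans (ler_normB _ _)); rewrite normrM normr_nat addrK.
  rewrite mulrDl mul1r lerD// ?ler_wpM2l ?ler_nat//.
  by apply: (le_trans (F_size _)); rewrite ler_nat.
pose dev u := `|F u - c * (size u)%:R|.
have dev_cat u v : dev (u ++ v) <= dev u + dev v + L.
  rewrite /dev size_cat natrD.
  have -> : F (u ++ v) - c * ((size u)%:R + (size v)%:R) =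
    (F u - c * (size u)%:R) + (F v - c * (size v)%:R) +
    (F (u ++ v) - (F u + F v)) by ring.
  by apply: (le_trans (ler_normD _ _)); rewrite lerD// ler_normD.
(* A factor is the end of a block followed by whole blocks and the beginning
   of a block: [pre] handles the part after the first block. *)
have pre v n : dev (take n (subst_word (W m) v)) <=
    2 * (e / 3) * (size (take n (subst_word (W m) v)))%:R + C.
  elim: v n => [|x v IH] n.
    rewrite /dev /= mulr0 subr0 mulr0 add0r.
    by apply: (le_trans (F_size _)).
  rewrite -cat1s subst_word_cat {1 3}/subst_word /= cats0 take_cat.
  case: ltnP => [n_lt|_].
    have /short : (size (take n (W m x)) <= B)%N.
      by rewrite size_takel ?(ltnW n_lt)// (leq_trans (ltnW n_lt)).
    move=> /le_trans; apply.
    have : 0 <= 2 * (e / 3) * (size (take n (W m x)))%:R.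
      by rewrite !mulr_ge0// ltW.
    by move: L_ge0; lra.
  apply: (le_trans (dev_cat _ _)); have [] := blk x.
  have := IH (n - size (W m x))%N.
  by rewrite size_cat natrD /dev; lra.
have mid v k n : dev (take n (drop k (subst_word (W m) v))) <=
    2 * (e / 3) * (size (take n (drop k (subst_word (W m) v))))%:R + 2 * C.
  elim: v k => [|x v IH] k.
    rewrite /dev /= mulr0 subr0 mulr0 add0r.
    by apply: (le_trans (F_size _)); rewrite mulr_ge0.
  rewrite -cat1s subst_word_cat {1 3}/subst_word /= cats0 drop_cat.
  case: ltnP => // k_lt.
  rewrite take_cat; case: ltnP => [n_lt|_].
    have /short : (size (take n (drop k (W m x))) <= B)%N.
      rewrite size_takel ?(ltnW n_lt)// (leq_trans (ltnW n_lt))//.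
      by rewrite size_drop (leq_trans (leq_subr _ _)).
    move=> /le_trans; apply.
    have : 0 <= 2 * (e / 3) * (size (take n (drop k (W m x))))%:R.
      by rewrite !mulr_ge0// ltW.
    by move: L_ge0 C_ge0; lra.
  apply: (le_trans (dev_cat _ _)).
  have /short : (size (drop k (W m x)) <= B)%N.
    by rewrite size_drop (leq_trans (leq_subr _ _)).
  have := pre v (n - size (drop k (W m x)))%N.
  have : 0 <= 2 * (e / 3) * (size (drop k (W m x)))%:R.
    by rewrite !mulr_ge0// ltW.
  by rewrite size_cat natrD /dev; lra.
have [n0 Cn0] : exists n0 : nat, 2 * C <= e / 3 * n0%:R.
  have /archi_boundP : 0 <= 2 * C / (e / 3).
    by rewrite mulr_ge0 ?invr_ge0 ?(ltW e3_gt0)// mulr_ge0.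
  move: (Num.bound _) => n0 /ltW; rewrite ler_pdivrMr ?divr_gt0// => Cn.
  by exists n0; rewrite [leRHS]mulrC.
exists n0 => n k n0n.
have [v wE] := limit_word_prefix m (k + n) s_gt0 w_lim.
have fE :
    take n (drop k (subst_word (W m) v)) = take n (drop k (mkseq w (k + n))).
  by rewrite wE addnC -take_drop take_takel.
have := mid v k n; rewrite fE /dev size_takel; last first.
  by rewrite size_drop size_mkseq addKn.
move=> /le_trans; apply.
have : e / 3 * n0%:R <= e / 3 * n%:R.
  by rewrite ler_wpM2l ?(ltW e3_gt0)// ler_nat.
lra.
Qed.

End uniform_frequency.

(** * Counting occurrences of patterns, a pattern being any set of words of length [l] *)

Section pattern_frequency.
Variables (R : realType) (P : pred (seq bool)) (l : nat).

Let window (f : nat -> bool) i := mkseq (fun j => f (i + j)%N) l.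

(** Windows overflowing [u] are completed by [false]. *)
Let occ (u : seq bool) : R := \sum_(i < size u) (P (window (nth false u) i))%:R.

Let sum_overflow_le n : (\sum_(i < n) (n < i + l) <= minn n l)%N.
Proof.
elim: n => [|n IH]; first by rewrite big_ord0.
rewrite big_ord_recl add0n.
under eq_bigr do rewrite lift0 addSn ltnS.
move: IH; move: (\sum_(i < n) _)%N => S.
by case: ltnP => /=; lia.
Qed.

(** Windows contained in the first [n] letters are windows of [f]; the others start among the last
    [l] positions. *)
Let occ_mkseq (f : nat -> bool) n :
  `|occ (mkseq f n) - \sum_(i < n) (P (window f i))%:R| <= l%:R.
Proof.
rewrite /occ size_mkseq -sumrB.
apply: (le_trans (ler_norm_sum _ _ _)).
apply: (@le_trans _ _ (\sum_(i < n) (n < i + l)%:R)); last first.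
  by rewrite -natr_sum ler_nat (leq_trans (sum_overflow_le n)) ?geq_minr.
apply: ler_sum => i _; case: ltnP => [_|iln].
  by case: (P _); case: (P _);
    rewrite ?subrr ?sub0r ?subr0 ?normrN ?normr0 ?normr1.
suff -> : window (nth false (mkseq f n)) i = window f i by rewrite subrr normr0.
apply/eq_in_map => j; rewrite mem_iota add0n => jl.
by rewrite nth_mkseq//; lia.
Qed.

Let occ_size u : `|occ u| <= (size u)%:R.
Proof.
apply: (le_trans (ler_norm_sum _ _ _)).
apply: (@le_trans _ _ (\sum_(i < size u) 1)).
  by apply: ler_sum => i _; rewrite normr_nat lern1 leq_b1.
by rewrite sumr_const card_ord.
Qed.

(** Windows starting in [v] are counted identically on both sides, so the error is that of
    truncating [u ++ v] after [u], which [occ_mkseq] bounds. *)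
Let occ_cat u v : `|occ (u ++ v) - (occ u + occ v)| <= l%:R.
Proof.
have := occ_mkseq (nth false (u ++ v)) (size u).
have -> : mkseq (nth false (u ++ v)) (size u) = u.
  apply: (@eq_from_nth _ false); rewrite size_mkseq// => i iu.
  by rewrite nth_mkseq// nth_cat iu.
rewrite distrC; congr (`| _ | <= _).
have -> : occ (u ++ v) =
    \sum_(i < size u) (P (window (nth false (u ++ v)) i))%:R + occ v.
  rewrite {1}/occ size_cat big_split_ord /=; congr (_ + _).
  apply: eq_bigr => i _.
  congr (P _)%:R; apply: eq_map => j.
  by rewrite nth_cat -addnA ltnNge leq_addr addKn.
ring.
Qed.

Lemma pattern_frequency a b (d : nat -> nat) (s : nat -> substitution) w :
  (0 < a)%N -> (0 < b)%N ->
  (forall n, 1 < d n)%N -> (forall n, a * b <= d n)%N ->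
  (forall n, s n false = nseq (d n) false ++ nseq a true) ->
  (forall n, s n true = nseq b false) ->
  is_limit_word s w ->
  exists c : R, forall e, 0 < e -> exists n0, forall n k, (n0 <= n)%N ->
    `|\sum_(i < n) (P (mkseq (fun j => w (k + i + j)%N) l))%:R - c * n%:R|
      <= e * n%:R.
Proof.
move=> a0 b0 d1 abd s0 s1 w_lim.
have [c c_freq] := uniform_frequency a0 b0 d1 abd s0 s1 occ_size occ_cat w_lim.
exists c => e e0; have e2_gt0 : 0 < e / 2 by rewrite divr_gt0.
have [n0 n0_freq] := c_freq _ e2_gt0.
(* The other half of [e] absorbs the windows that overflow the factor on the right. *)
have [n1 ln1] : exists n1 : nat, l%:R <= e / 2 * n1%:R.
  have /archi_boundP : 0 <= l%:R / (e / 2) by rewrite divr_ge0// ltW.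
  move: (Num.bound _) => n1 /ltW; rewrite ler_pdivrMr// => len.
  by exists n1; rewrite [leRHS]mulrC.
exists (n0 + n1)%N => n k n01n.
have := n0_freq n k; rewrite (leq_trans (leq_addr _ _) n01n) => /(_ isT).
have -> : take n (drop k (mkseq w (k + n))) = mkseq (fun i => w (k + i)%N) n.
  have size_n : size (take n (drop k (mkseq w (k + n)))) = n.
    by rewrite size_takel// size_drop size_mkseq addKn.
  apply: (@eq_from_nth _ false); rewrite size_n ?size_mkseq// => i ltin.
  by rewrite nth_take// nth_drop !nth_mkseq ?ltn_add2l.
have := occ_mkseq (fun i => w (k + i)%N) n.
have : e / 2 * n1%:R <= e / 2 * n%:R.
  by rewrite ler_wpM2l ?(ltW e2_gt0)// ler_nat (leq_trans (leq_addl _ _) n01n).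
have -> : \sum_(i < n) (P (mkseq (fun j => w (k + i + j)%N) l))%:R =
    \sum_(i < n) (P (window (fun i => w (k + i)%N) i))%:R :> R.
  apply: eq_bigr => i _; congr (P _)%:R; apply: eq_map => j.
  by rewrite addnA.
rewrite !ler_norml !lerBlDr => ? /andP[? ?] /andP[? ?].
apply/andP; split; lra.
Qed.

End pattern_frequency.

(** * The Borel sigma-algebra of a subshift *)

Lemma nbhs_mkseq (y : cantor_space) l :
  nbhs y [set z : cantor_space | mkseq z l = mkseq y l].
Proof.
elim: l => [|l IH]; first by apply: filterS filterT => z.
have := @proj_continuous _ (fun _ : nat => bool) l y _ (discrete_set1 (y l)).
apply: filterS2 IH => z zy zyl; rewrite /= /mkseq -addn1 !iotaD !map_cat /=.
by rewrite add0n -/(mkseq z l) (zyl : z l = y l) zy.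
Qed.

(** The filter generated by the cylinders around [y] converges to [y]: this is checked
    coordinatewise, a prefix of length i+1 fixing coordinate i. *)
Lemma nbhs_cantorP (y : cantor_space) (U : set cantor_space) : nbhs y U ->
  exists l, forall z, mkseq z l = mkseq y l -> U z.
Proof.
pose F : set_system cantor_space :=
  [set V | exists l, forall z, mkseq z l = mkseq y l -> V z].
have F_filter : Filter F.
  split; first by exists 0.
    move=> V1 V2 [l1 V1l] [l2 V2l]; exists (maxn l1 l2) => z zy.
    have sub l : (l <= maxn l1 l2)%N -> mkseq z l = mkseq y l.
      move=> /minn_idPl lE; have := congr1 (take l) zy.
      by rewrite /mkseq -!map_take take_iota lE.
    by split; [apply/V1l/sub/leq_maxl|apply/V2l/sub/leq_maxr].
  by move=> V1 V2 V12 [l V1l]; exists l => z /V1l /V12.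
suff : F --> y by apply.
apply/cvg_sup => i V.
rewrite (@nbhsE
  (@initial_topology (prod_topology (fun _ : nat => bool)) bool (@^~ i))).
move=> -[_ [[C _ <-] Cy] CV]; exists i.+1 => z zy.
apply: CV; rewrite /preimage /=.
have := congr1 (fun u => nth false u i) zy.
by rewrite !nth_mkseq// => ->.
Qed.

(** * Sets determined by finitely many letters *)

Section subshift.
Variable nu : cantor_space.
Local Notation X := (subshift nu).
Local Notation T := (@subshift_map nu).

(** Here [point] is [nu] itself, viewed in its subshift. *)
Definition subshift_orbit k : X := iter k T point.

Lemma val_iter_subshift_map k (y : X) i :
  \val (iter k T y) i = \val y (k + i)%N.
Proof. by elim: k i => // k IH i; rewrite iterS /= /left_shift IH addnS. Qed.

Lemma val_subshift_orbit k i : \val (subshift_orbit k) i = nu (k + i)%N.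
Proof. exact: val_iter_subshift_map. Qed.

Lemma iter_left_shift k (y : cantor_space) i :
  iter k left_shift y i = y (k + i)%N.
Proof. by elim: k i => // k IH i; rewrite iterS /left_shift IH addnS. Qed.

Lemma subshift_orbit_dense (y : X) l :
  exists k, mkseq (\val (subshift_orbit k)) l = mkseq (\val y) l.
Proof.
have [_ [[k _ <-] ky]] := set_mem (valP y) _ (nbhs_mkseq (\val y) l).
exists k; rewrite -ky; apply: eq_map => i.
by rewrite val_subshift_orbit iter_left_shift.
Qed.

(** These sets are the finite unions of cylinders. They form an algebra that generates the Borel
    sets and on which frequencies exist. *)
Definition window_set l (A : set X) :=
  forall y z : X, mkseq (\val y) l = mkseq (\val z) l -> A y -> A z.

Definition window_sets : set (set X) := [set A | exists l, window_set l A].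

Lemma window_set_le l l' A : (l <= l')%N -> window_set l A -> window_set l' A.
Proof.
move=> ll' Al y z yz; apply: Al; have := congr1 (take l) yz.
by rewrite /mkseq -!map_take take_iota; move/minn_idPl: ll' => ->.
Qed.

Lemma window_sets0 : window_sets set0.
Proof. by exists 0. Qed.

Lemma window_setsU : setU_closed window_sets.
Proof.
move=> A B [l Al] [m Bm]; exists (maxn l m) => y z yz [Ay|By]; [left|right].
  exact: (window_set_le (leq_maxl l m) Al) Ay.
exact: (window_set_le (leq_maxr l m) Bm) By.
Qed.

Lemma window_setsC : setC_closed window_sets.
Proof. by move=> A [l Al]; exists l => y z yz nAy Az; apply/nAy/Al/Az. Qed.

Lemma window_sets_preimage k A :
  window_sets A -> window_sets (iter k T @^-1` A).
Proof.
move=> [l Al]; exists (k + l)%N => y z yz; apply: Al.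
have := congr1 (drop k) yz; rewrite /mkseq -!map_drop drop_iota addKn add0n.
rewrite -[k in iota k]addn0 iotaDl -!map_comp => E.
have {}E i : (i < l)%N -> \val y (k + i)%N = \val z (k + i)%N.
  move=> il; have := congr1 (fun u => nth false u i) E.
  by rewrite !(nth_map 0%N) ?size_iota// nth_iota.
apply/eq_in_map => i; rewrite mem_iota => /andP[_ il].
by rewrite !val_iter_subshift_map E.
Qed.

(** Compactness of the Cantor space: a cluster point of a choice of [y n] in [B n] shares
    arbitrarily long prefixes with late [y m], which puts it into the subshift and into each
    [B n]. *)
Lemma window_sets_nested (B : nat -> set X) :
  (forall n, window_sets (B n)) -> (forall n, B n.+1 `<=` B n) ->
  (forall n, B n !=set0) -> exists y, forall n, B n y.
Proof.
move=> Bw Bdec Bn0.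
have {}Bdec m n : (m <= n)%N -> B n `<=` B m.
  move=> /subnKC <-.
  by elim: (n - m)%N => [|k IH]; rewrite ?addn0 ?addnS// => y /Bdec /IH.
pose y n : X := xget point (B n).
have By n : B n (y n) by apply: xgetPex; exact: Bn0.
have [z [_ z_clu]] := @cantor_space_compact
  ((fun n => \val (y n)) @ \oo) _ filterT.
have z_near n l : exists2 m, (n <= m)%N & mkseq (\val (y m)) l = mkseq z l.
  have yn : ((fun n => \val (y n)) @ \oo)
      [set \val (y m) | m in [set m | (n <= m)%N]].
    by exists n => // m nm; exists m.
  by have [_ [[m nm <-] mz]] := z_clu _ _ yn (nbhs_mkseq z l); exists m.
have z_in : orbit_closure nu z.
  move=> U /nbhs_cantorP[l zU]; have [m _ mz] := z_near 0 l.
  have [k ky] := subshift_orbit_dense (y m) l.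
  exists (iter k left_shift nu); split; first by exists k.
  apply: zU; rewrite -mz -ky; apply: eq_map => i.
  by rewrite val_subshift_orbit iter_left_shift.
exists (exist _ z (mem_set z_in)) => n.
have [l Bl] := Bw n; have [m nm mz] := z_near n l.
apply: (Bl (y m) _ _ (Bdec _ _ nm _ (By m))).
exact: mz.
Qed.

Lemma open_window_set A : window_sets A -> open A.
Proof.
move=> [l Al]; rewrite openE => y Ay.
have val_cont : continuous (\val : X -> cantor_space).
  by have := @initial_continuous (orbit_closure nu) cantor_space set_val.
have : nbhs y [set z : X | mkseq (\val z) l = mkseq (\val y) l].
  exact: val_cont (nbhs_mkseq (\val y) l).
by apply: filterS => z zy; apply: Al (esym zy) Ay.
Qed.

Lemma open_bigcup_window_set (U : set X) : open U ->
  exists2 F : nat -> set X, (forall n, window_sets (F n)) & U = \bigcup_n F n.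
Proof.
move=> [V Vo <-].
pose C (u : seq bool) : set X := [set y | mkseq (\val y) (size u) = u].
(* Finite words are countable: [n] codes a word, whose cylinder is kept if it lies inside the open
   set and replaced by [set0] otherwise. *)
exists (fun n => if unpickle n is Some u then
  (if `[< C u `<=` \val @^-1` V >] then C u else set0) else set0).
  move=> n; case: unpickle => [u|]; last exact: window_sets0.
  case: ifP => _; last exact: window_sets0.
  by exists (size u) => y z yz; rewrite /C /= -yz.
apply/seteqP; split=> [y Vy|y [n _]]; last first.
  by case: unpickle => [u|//]; case: ifP => // /asboolP; exact.
have /nbhs_cantorP[l yV] : nbhs (\val y) V by apply: open_nbhs_nbhs.
exists (pickle (mkseq (\val y) l)) => //; rewrite pickleK.
have -> : `[< C (mkseq (\val y) l) `<=` \val @^-1` V >].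
  by apply/asboolP => z; rewrite /C /= size_mkseq; exact: yV.
by rewrite /C /= size_mkseq.
Qed.

Lemma sigma_window_sets : <<s window_sets >> = <<s (@open X) >>.
Proof.
apply/seteqP; split; apply: smallest_sub; try exact: smallest_sigma_algebra.
  by move=> A /open_window_set; exact: sub_sigma_algebra.
move=> U /open_bigcup_window_set[F Fw ->].
apply: sigma_algebra_bigcup => n; exact: sub_sigma_algebra.
Qed.

End subshift.

(** * Unique ergodicity from uniform frequencies *)

Section probability_of_measure.
Context d (T : measurableType d) (R : realType).
Variables (m : {measure set T -> \bar R}) (m1 : m setT = 1%E).

(** The proof of total mass one is an argument so that the probability instance can be inferred from
    the term. *)
Definition probability_of_measure of m setT = 1%E : set T -> \bar R := m.

HB.instance Definition _ := Measure.on (probability_of_measure m1).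
HB.instance Definition _ :=
  Measure_isProbability.Build _ _ _ (probability_of_measure m1) m1.

End probability_of_measure.

(** A copy of the subshift, equipped with the algebra of window sets instead of
    its Borel sigma-algebra. *)
Definition windowed (nu : cantor_space) : Type := subshift nu.

HB.instance Definition _ nu := Pointed.copy (windowed nu) (subshift nu).
HB.instance Definition _ nu := @isAlgebraOfSets.Build default_measure_display
  (windowed nu) (@window_sets nu) (@window_sets0 nu) (@window_setsU nu)
  (@window_setsC nu).

(** * Visit frequencies and the measure that they define *)

Section frequency.
Variables (R : realType) (nu : cantor_space).
Local Notation X := (subshift nu).
Local Notation T := (@subshift_map nu).

Definition visits (A : set X) n (y : X) : R := \sum_(i < n) \1_A (iter i T y).

Definition has_frequency (A : set X) (c : R) := forall e, 0 < e ->
  exists n0, forall n y, (n0 <= n)%N -> `|visits A n y - c * n%:R| <= e * n%:R.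

(** With default 0 this is nonnegative on every set, as the structure of measures demands. *)
Definition frequency A : R := xget 0 (has_frequency A).

Lemma has_frequency_approx A c e : has_frequency A c -> 0 < e ->
  exists2 n, (0 < n)%N & forall y, `|visits A n y - c * n%:R| <= e * n%:R.
Proof.
move=> Ac e0; have [n0 n0P] := Ac e e0.
by exists n0.+1 => // y; exact: n0P.
Qed.

Lemma has_frequency_unique A c c' :
  has_frequency A c -> has_frequency A c' -> c = c'.
Proof.
move=> Ac Ac'; apply/eqP; rewrite -subr_eq0 -normr_le0.
apply/ler_addgt0Pr => e e0; rewrite add0r [leRHS]splitr.
have e2 : 0 < e / 2 by rewrite divr_gt0.
have [n1 n1P] := Ac _ e2; have [n2 n2P] := Ac' _ e2.
pose n := (n1 + n2).+1; have n0 : 0 < n%:R :> R by rewrite ltr0n.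
rewrite -(ler_pM2r n0) -{1}[n%:R]gtr0_norm// -normrM [leRHS]mulrDl.
have := n1P n point; have := n2P n point.
have -> : (n2 <= n)%N by rewrite /n; lia.
have -> : (n1 <= n)%N by rewrite /n; lia.
move=> /(_ isT); rewrite distrC => n2le /(_ isT) n1le.
rewrite [X in `|X|](_ : _ = - (visits A n point - c * n%:R) -
  (c' * n%:R - visits A n point)); last by ring.
rewrite (le_trans (ler_normB _ _))// normrN; exact: lerD.
Qed.

Lemma frequencyE A c : has_frequency A c -> frequency A = c.
Proof.
by move=> Ac; apply: (has_frequency_unique _ Ac); apply: xgetPex; exists c.
Qed.

Lemma has_frequency0 : has_frequency set0 0.
Proof.
move=> e e0; exists 0 => n y _; rewrite mul0r subr0 /visits big1 ?normr0.
  by rewrite mulr_ge0// ltW.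
by move=> i _; rewrite indicE in_set0.
Qed.

Lemma has_frequencyT : has_frequency setT 1.
Proof.
move=> e e0; exists 0 => n y _.
have -> : visits setT n y = n%:R.
  rewrite /visits; under eq_bigr do rewrite indicE in_setT.
  by rewrite sumr_const card_ord.
by rewrite mul1r subrr normr0 mulr_ge0// ltW.
Qed.

Lemma has_frequencyU A B a b : A `&` B = set0 ->
  has_frequency A a -> has_frequency B b -> has_frequency (A `|` B) (a + b).
Proof.
move=> AB0 Aa Bb e e0; have e2 : 0 < e / 2 by rewrite divr_gt0.
have [n1 n1P] := Aa _ e2; have [n2 n2P] := Bb _ e2.
exists (n1 + n2)%N => n y n12n.
have -> : visits (A `|` B) n y = visits A n y + visits B n y.
  rewrite /visits -big_split; apply: eq_bigr => i _ /=.
  rewrite !indicE in_setU.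
  have [|_] := boolP (_ \in A); have [|_] := boolP (_ \in B);
    rewrite ?addr0 ?add0r//.
  rewrite !inE => By Ay; suff : set0 (iter i T y) by [].
  by rewrite -AB0.
have -> : visits A n y + visits B n y - (a + b) * n%:R =
  (visits A n y - a * n%:R) + (visits B n y - b * n%:R) by ring.
rewrite (le_trans (ler_normD _ _))// [in leRHS](splitr e) mulrDl.
rewrite lerD//; [apply: n1P|apply: n2P]; apply: leq_trans n12n.
  exact: leq_addr.
exact: leq_addl.
Qed.

Lemma has_frequency_ge0 A c : has_frequency A c -> 0 <= c.
Proof.
move=> Ac; apply/ler_addgt0Pr => e e0.
have [n n0 /(_ point)] := has_frequency_approx Ac e0.
have nR : 0 < n%:R :> R by rewrite ltr0n.
rewrite -(pmulr_lge0 _ nR) ler_norml => /andP[_].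
have : 0 <= visits A n point by apply: sumr_ge0 => i _; rewrite indicE.
by rewrite lerBlDr mulrDl; lra.
Qed.

Lemma frequency_ge0 A : 0 <= frequency A.
Proof.
by rewrite /frequency; case: xgetP => // c _ /has_frequency_ge0.
Qed.

(** Visits of [y] to the preimage are visits of [T y] to [A], and the bound is uniform in the
    starting point. This makes the measure invariant. *)
Lemma has_frequency_preimage A c :
  has_frequency A c -> has_frequency (T @^-1` A) c.
Proof.
move=> Ac e /Ac[n0 n0P]; exists n0 => n y n0n.
have <- : visits A n (T y) = visits (T @^-1` A) n y; last exact: n0P.
by apply: eq_bigr => i _; rewrite !indicE /preimage -iterSr.
Qed.

Hypothesis pattern_freq : forall (P : pred (seq bool)) l,
  exists c : R, forall e, 0 < e -> exists n0, forall n k, (n0 <= n)%N ->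
    `|\sum_(i < n) (P (mkseq (fun j => nu (k + i + j)%N) l))%:R - c * n%:R|
      <= e * n%:R.

(** The first [n] visits of [y] depend only on its first [n + l] letters, which also begin some
    shift of [nu]; uniformity in the position [k] then transfers the frequency to [y]. *)
Lemma exists_frequency A : window_sets A -> exists c, has_frequency A c.
Proof.
move=> [l Al].
pose P (u : seq bool) := `[< exists2 z : X, A z & mkseq (\val z) l = u >].
have [c Pc] := pattern_freq P l; exists c => e /Pc[n0 n0P].
exists n0 => n y n0n.
have [k ky] := subshift_orbit_dense y (n + l).
have := n0P n k n0n; congr (`|_ - _| <= _); apply: eq_bigr => i _.
have -> : mkseq (fun j => nu (k + i + j)%N) l = mkseq (\val (iter i T y)) l.
  apply/eq_in_map => j; rewrite mem_iota => /andP[_ jl].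
  rewrite val_iter_subshift_map -addnA -val_subshift_orbit.
  have ijnl : (i + j < n + l)%N by have := ltn_ord i; lia.
  have := congr1 (fun u => nth false u (i + j)) ky.
  by rewrite !nth_mkseq.
rewrite indicE; congr (_%:R); congr nat_of_bool; apply/asboolP/idP.
  by move=> [z Az zy]; rewrite inE; exact: Al zy Az.
by rewrite inE => Ay; exists (iter i T y).
Qed.

Lemma frequencyP A : window_sets A -> has_frequency A (frequency A).
Proof. by move=> /exists_frequency[c Ac]; rewrite (frequencyE Ac). Qed.

Lemma frequencyU A B : window_sets A -> window_sets B -> A `&` B = set0 ->
  frequency (A `|` B) = frequency A + frequency B.
Proof.
by move=> /frequencyP Aw /frequencyP Bw AB0; apply/frequencyE/has_frequencyU.
Qed.

Let frequency_bigsetU (F : nat -> set X) n :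
  (forall i, window_sets (F i)) -> trivIset setT F ->
  (frequency (\big[setU/set0]_(i < n) F i))%:E =
  (\sum_(i < n) (frequency (F i))%:E)%E.
Proof.
move=> Fw Ftriv; pose f (A : set (windowed nu)) : \bar R := (frequency A)%:E.
have f0 : f set0 = 0%E by rewrite /f (frequencyE has_frequency0).
have /(additive2P f0) : additive2 f.
  by move=> A B Aw Bw AB0; rewrite /f frequencyU// EFinD.
apply => //; apply: bigsetU_measurable => i _; exact: Fw.
Qed.

(** If a countable disjoint union is again a window set, its remainders are nested window sets with
    empty intersection, so one of them is empty. The partial sums are thus eventually constant. *)
Lemma frequency_sigma_additive : semi_sigma_additive
  (fun A : set (windowed nu) => (frequency A)%:E).
Proof.
move=> F Fw Ftriv UFw; apply: cvg_near_cst.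
pose B n : set (windowed nu) := (\bigcup_k F k) `\` \big[setU/set0]_(i < n) F i.
have Bw n : measurable (B n).
  by apply: measurableD => //; apply: bigsetU_measurable.
have [m Bm0] : exists m, B m = set0.
  apply: contrapT => /forallNP Bn0.
  have [|n|y By] := @window_sets_nested nu B Bw.
  - move=> n y [Fy nFy]; split=> // Uy; apply: nFy.
    by rewrite big_ord_recr; left.
  - by apply/set0P/eqP/Bn0.
  have [[k _ Fky] _] := By 0.
  by have [_] := By k.+1; apply; rewrite big_ord_recr; right.
exists m => // n /= mn; rewrite big_mkord -frequency_bigsetU//; congr (frequency _)%:E.
apply/seteqP; split=> y.
  by rewrite -bigcup_mkord => -[k _ Fky]; exists k.
move=> [k _ Fky]; apply: contrapT => nUy.
have : B m y.
  split; first by exists k.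
  rewrite -bigcup_mkord => -[j /= jm Fjy]; apply: nUy.
  by rewrite -bigcup_mkord; exists j => //=; exact: leq_trans mn.
by rewrite Bm0.
Qed.

(** This is the Carathéodory extension from the algebra of window sets. *)
Lemma exists_frequency_measure : exists mu : probability (borel X) R,
  forall A, window_sets A -> mu A = (frequency A)%:E.
Proof.
pose f (A : set (windowed nu)) : \bar R := (frequency A)%:E.
have f0 : f set0 = 0%E by rewrite /f (frequencyE has_frequency0).
have f_ge0 A : (0 <= f A)%E by rewrite lee_fin frequency_ge0.
pose fm : {measure set (windowed nu) -> \bar R} := HB.pack f
  (isMeasure.Build _ _ _ f f0 f_ge0 frequency_sigma_additive).
have extE A : window_sets A -> measure_extension fm A = (frequency A)%:E.
  move=> Aw; exact: (measurable_mu_extE fm Aw).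
pose g : set (borel X) -> \bar R := measure_extension fm.
have g0 : g set0 = 0%E := measure0 (measure_extension fm).
have g_ge0 A : (0 <= g A)%E := measure_ge0 (measure_extension fm) A.
(* The extension lives on the sigma-algebra generated by window sets; [sigma_window_sets] carries
   its additivity over to the Borel sets. *)
have g_sigma : semi_sigma_additive g.
  move=> F mF tF mUF.
  apply: (@measure_semi_sigma_additive _ _ _ (measure_extension fm)).
  - by move=> i; have := mF i; rewrite /measurable /= -sigma_window_sets.
  - exact: tF.
  - by have := mUF; rewrite /measurable /= -sigma_window_sets.
have [gm gmE] : exists gm : {measure set (borel X) -> \bar R},
    gm = g :> (set (borel X) -> \bar R).
  pose gm : {measure set (borel X) -> \bar R} := HB.pack g
    (isMeasure.Build _ _ _ g g0 g_ge0 g_sigma).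
  by exists gm.
have gmw A : window_sets A -> gm A = (frequency A)%:E.
  by rewrite gmE; exact: extE.
have gmT : gm setT = 1%E.
  by rewrite gmw ?(frequencyE has_frequencyT)//;
    exact: (@measurableT _ (windowed nu)).
by exists (probability_of_measure gmT : probability (borel X) R).
Qed.

Lemma measurable_window_set A : window_sets A -> measurable (A : set (borel X)).
Proof. by move=> /open_window_set; exact: sub_sigma_algebra. Qed.

(** Window sets are a generating family closed under intersection and containing the whole space. *)
Lemma eq_measure_window_sets (m1 m2 : {measure set (borel X) -> \bar R}) :
  (m1 setT < +oo)%E -> (forall A, window_sets A -> m1 A = m2 A) ->
  forall A, measurable A -> m1 A = m2 A.
Proof.
move=> m1T m12 A.
have mG : @measurable _ (borel X) = <<s (@window_sets nu) >>.
  by rewrite sigma_window_sets.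
apply: (@measure_unique _ R (borel X) _ (fun=> setT) mG) => //.
- exact: (@measurableI _ (windowed nu)).
- by move=> _; exact: (@measurableT _ (windowed nu)).
- by rewrite bigcup_const.
Qed.

Lemma measurable_subshift_map :
  measurable_fun setT (T : borel X -> borel X).
Proof.
have mG : @measurable _ (borel X) = <<s (@window_sets nu) >>.
  by rewrite sigma_window_sets.
apply: (@measurability _ _ (borel X) (borel X) setT T _ mG).
move=> _ [A Aw <-]; rewrite setTI.
apply: measurable_window_set; exact: (window_sets_preimage 1 Aw).
Qed.

Lemma probability_lty (mu : probability (borel X) R) : (mu setT < +oo)%E.
Proof. by rewrite probability_setT ltry. Qed.

(* Integrating nonnegative functions yields the upper bound; the lower bound
   comes from the complement of [A]. *)
Lemma invariant_measure_window_le (mu : probability (borel X) R) A :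
  invariant_measure T mu -> window_sets A -> (mu A <= (frequency A)%:E)%E.
Proof.
move=> mu_inv Aw; apply/lee_addgt0Pr => e e0.
have [n n0 nP] := has_frequency_approx (frequencyP Aw) e0.
have mA i : measurable (iter i T @^-1` A : set (borel X)).
  by apply: measurable_window_set; exact: window_sets_preimage.
have mu_iter i : mu (iter i T @^-1` A) = mu A.
  elim: i => // i <-; rewrite -(mu_inv _ (mA i)).
  by congr (mu _); apply/funext => y; rewrite /preimage /= -iterSr.
have mind i : measurable_fun setT
    (EFin \o (\1_(iter i T @^-1` A) : borel X -> R)).
  by apply: measurableT_comp => //; exact: measurable_indic.
(* By invariance each of the [n] summands integrates to [mu A]. *)
have int_visits : (\int[mu]_y (visits A n y)%:E = n%:R%:E * mu A)%E.
  rewrite /visits; under eq_integral do rewrite -sumEFin.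
  rewrite (@ge0_integral_sum _ (borel X) R mu setT measurableT _
    (fun (i : 'I_n) y => (\1_(iter i T @^-1` A) y)%:E)).
  - rewrite (eq_bigr (fun=> mu A)).
      by rewrite sumr_const card_ord mule_natl.
    by move=> i _; rewrite integral_indic// setIT; exact: mu_iter.
  - by move=> i; exact: mind.
  - by move=> i y _; rewrite lee_fin.
have : (\int[mu]_y (visits A n y)%:E <=
    \int[mu]_y (cst ((frequency A + e) * n%:R)%:E y))%E.
  apply: ge0_le_integral => //.
  - by move=> y _; rewrite lee_fin sumr_ge0.
  - under eq_fun do rewrite /visits -sumEFin.
    by apply: emeasurable_sum => i; exact: mind.
  - move=> y _; rewrite lee_fin.
    by have := nP y; rewrite ler_norml => /andP[_]; rewrite mulrDl; lra.
have int_cst : (\int[mu]_y (cst ((frequency A + e) * n%:R)%:E y) =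
    n%:R%:E * ((frequency A)%:E + e%:E))%E.
  rewrite integral_cst// mulrC EFinM EFinD -[RHS]mule1; congr (_ * _)%E.
  exact: probability_setT.
by rewrite int_visits int_cst lee_pmul2l// lte_fin ltr0n.
Qed.

Lemma invariant_measure_window (mu : probability (borel X) R) A :
  invariant_measure T mu -> window_sets A -> mu A = (frequency A)%:E.
Proof.
move=> mu_inv Aw; apply/eqP; rewrite eq_le invariant_measure_window_le//=.
have := invariant_measure_window_le mu_inv (window_setsC Aw).
rewrite probability_setC; last exact: measurable_window_set.
have -> : frequency (~` A) = 1 - frequency A.
  rewrite -(frequencyE has_frequencyT) -(setvU A).
  by rewrite frequencyU ?addrK ?setICl//; exact: window_setsC.
have /fineK <- : mu A \is a fin_num.
  by apply: fin_num_measure; exact: measurable_window_set.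
by rewrite -EFinB !lee_fin; lra.
Qed.

Lemma uniquely_ergodic_subshift : uniquely_ergodic R T.
Proof.
have [mu mu_freq] := exists_frequency_measure; exists mu; split=> [A mA|].
  pose phi : {mfun borel X >-> borel X} := HB.pack (T : borel X -> borel X)
    (isMeasurableFun.Build _ _ (borel X) (borel X) T measurable_subshift_map).
  (* Invariance says that [mu] equals its pushforward, which only has to be tested on window
     sets. *)
  apply: (@eq_measure_window_sets (pushforward mu phi) mu) => //.
    exact: probability_lty.
  move=> B Bw; apply: (etrans (mu_freq _ (window_sets_preimage 1 Bw))).
  apply: etrans (esym (mu_freq _ Bw)).
  exact/(congr1 EFin)/frequencyE/has_frequency_preimage/frequencyP.
move=> mu' mu'_inv; apply: (@eq_measure_window_sets mu' mu).
  exact: probability_lty.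
move=> A Aw; apply: etrans (esym (mu_freq _ Aw)).
exact: invariant_measure_window.
Qed.

End frequency.

Theorem corollary5p14 (R : realType) (N : nat) (x : R) (hN : (2 <= N)%N)
    (hx01 : 0 <= x <= 1) (hx_irr : irrational x) :
  uniquely_ergodic R (@subshift_map (ncf_seq N x)) /\
  uniquely_ergodic R (@subshift_map (dual_ncf_seq N x)).
Proof.
have N0 : (0 < N)%N := ltnW hN.
have d_ge n : (N <= ncf_digit N x n)%N by exact: ncf_digit_ge.
have d_gt1 n : (1 < ncf_digit N x n)%N := leq_trans hN (d_ge n).
(* The exponents (a, b) are (N, 1) for the NCF sequence and (1, N) for its dual. In both cases ab =
   N is at most every digit, and N >= 2 makes all digits exceed 1. *)
split; apply: uniquely_ergodic_subshift => P l.
  apply: (@pattern_frequency R P l N 1 (ncf_digit N x) (ncf_subst N x)) => //.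
    by move=> n; rewrite muln1.
  by apply: getPex; have [w []] := ncf_seq_unique N0 hx01 hx_irr; exists w.
apply: (@pattern_frequency R P l 1 N (ncf_digit N x) (dual_ncf_subst N x))
  => //.
  by move=> n; rewrite mul1n.
by apply: getPex; have [w []] := dual_ncf_seq_unique N0 hx01 hx_irr; exists w.
Qed.
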